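(* Let $\Gamma$ be an Abelian group with $|\Gamma|=2^{2\alpha}$, where $\alpha\geq 2$ is an integer. Then there exists a $\Gamma$-magic square $\mathrm{MS}_{\Gamma}(2^{\alpha})$ of side $2^\alpha$.
   Context: For an Abelian group $(\Gamma,+)$ of order $n^2$, a $\Gamma$-magic square $\mathrm{MS}_{\Gamma}(n)$ (of side $n$) is an $n\times n$ array whose entries are all the elements of $\Gamma$ (each element appearing exactly once) such that all row sums, all column sums, the sum along the main diagonal and the sum along the backward main diagonal are equal to the same element $\mu\in\Gamma$. *)

(* Defs.v *)
From HB Require Import structures.
From mathcomp Require Import all_boot all_order all_algebra.

Set Implicit Arguments.
Unset Strict Implicit.
Unset Printing Implicit Defensive.

Import GRing.Theory.
Local Open Scope ring_scope.

(* Bijectivity of the entry map says that every element of the group occurs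
   exactly once; in particular it forces #|G| = n ^ 2. *)
Definition magic_square (G : finZmodType) (n : nat) (M : 'M[G]_n) : Prop :=
  bijective (fun p : 'I_n * 'I_n => M p.1 p.2) /\
  exists mu : G,
    [/\ forall i : 'I_n, \sum_(j < n) M i j = mu,
        forall j : 'I_n, \sum_(i < n) M i j = mu,
        \sum_(i < n) M i i = mu
      & \sum_(i < n) M i (rev_ord i) = mu].

(* Main.v *)
(** If [K] has index 4 in [L], a magic square [f] of side [2k] on [K] yields one
    of side [4k] on [L]: replace each cell [x] of [f] by the 2x2 block of the
    four elements [x + c], [c] running over coset representatives, arranged by
    repeating a diagonal Latin square of order 4 whose four 2x2 quadrants each
    contain all four symbols.  Every line then meets each coset equally often,
    and its [K]-part is twice the corresponding line sum of [f].  Only the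
    doubled line sums of [f] matter, so any 2x2 filling of a Klein subgroup
    serves as [f]: this settles the non-cyclic groups of order 16, and the
    classical 4x4 magic square settles the cyclic one. *)
Require Import Defs.
From HB Require Import structures.
From mathcomp Require Import all_boot all_order all_algebra.
From mathcomp Require Import all_fingroup all_solvable zify.

Set Implicit Arguments.
Unset Strict Implicit.
Unset Printing Implicit Defensive.

Import GRing.Theory FinRing.Theory.
Local Open Scope ring_scope.

(* Arrays are indexed by [nat] and only constrained on [i, j < n]; the line sums
   are only required to agree after multiplication by [d]. *)
Definition square_in (G : finZmodType) (K : {set G}) (d n : nat)
    (f : nat -> nat -> G) : Prop :=
  [/\ forall i j, (i < n)%N -> (j < n)%N -> f i j \in K,
      forall i j i' j', (i < n)%N -> (j < n)%N -> (i' < n)%N -> (j' < n)%N ->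
        f i j = f i' j' -> i = i' /\ j = j'
    & exists mu,
      [/\ forall i, (i < n)%N -> (\sum_(j < n) f i j) *+ d = mu,
          forall j, (j < n)%N -> (\sum_(i < n) f i j) *+ d = mu,
          (\sum_(i < n) f i i) *+ d = mu
        & (\sum_(i < n) f i (n - i.+1)%N) *+ d = mu]].

Definition diagonal_latin4 (i j : nat) : nat :=
  nth 0%N (nth [::] [:: [:: 0; 1; 3; 2]; [:: 2; 3; 1; 0];
                        [:: 1; 0; 2; 3]; [:: 3; 2; 0; 1]] i) j.

(** Dürer's square from Melencolia I with every entry lowered by one, so that the entries are 0 to
    15. *)
Definition classical_square4 (i j : nat) : nat :=
  nth 0%N (nth [::] [:: [:: 15; 2; 1; 12]; [:: 4; 9; 10; 7];
                        [:: 8; 5; 6; 11]; [:: 3; 14; 13; 0]] i) j.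

Lemma diagonal_latin4_lt i j : (diagonal_latin4 i j < 4)%N.
Proof.
by case: i j => [|[|[|[|i]]]] [|[|[|[|j]]]] //=; rewrite /diagonal_latin4 /= ?nth_nil.
Qed.

Lemma diagonal_latin4_block_inj i j i' j' :
  (i < 4)%N -> (j < 4)%N -> (i' < 4)%N -> (j' < 4)%N ->
  (i %/ 2 = i' %/ 2)%N -> (j %/ 2 = j' %/ 2)%N ->
  diagonal_latin4 i j = diagonal_latin4 i' j' -> i = i' /\ j = j'.
Proof.
case: i => [|[|[|[|i]]]] //; case: i' => [|[|[|[|i']]]] // _;
by case: j => [|[|[|[|j]]]] //; case: j' => [|[|[|[|j']]]].
Qed.

(** Among [4 * k] consecutive cells each index [j %/ 2] occurs twice and each residue modulo 4
    occurs [k] times. Rows, columns and both diagonals of the enlarged array all have this shape. *)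
Lemma sum_block_line (V : zmodType) (F h : nat -> V) (k : nat) :
  \sum_(j < 4 * k) (F (j %/ 2)%N + h (j %% 4)%N) =
  (\sum_(j < 2 * k) F j) *+ 2 + (h 0%N + h 1%N + h 2%N + h 3%N) *+ k.
Proof.
elim: k => [|k IH]; first by rewrite !muln0 !big_ord0 mul0rn addr0.
have -> : (4 * k.+1 = (4 * k).+4)%N by lia.
have -> : (2 * k.+1 = (2 * k).+2)%N by lia.
rewrite !big_ord_recr /= IH.
have -> : (4 * k %/ 2 = 2 * k)%N by lia.
have -> : ((4 * k).+1 %/ 2 = 2 * k)%N by lia.
have -> : ((4 * k).+2 %/ 2 = (2 * k).+1)%N by lia.
have -> : ((4 * k).+3 %/ 2 = (2 * k).+1)%N by lia.
have -> : (4 * k %% 4 = 0)%N by lia.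
have -> : ((4 * k).+1 %% 4 = 1)%N by lia.
have -> : ((4 * k).+2 %% 4 = 2)%N by lia.
have -> : ((4 * k).+3 %% 4 = 3)%N by lia.
rewrite (mulrSr _ k) !mulr2n.
set S := \sum_(_ < _) _; set H := _ *+ k.
by rewrite (AC (3*2*2*2*2) ((1*4*8)*(2*6*10)*(3*(5*7*9*11)))).
Qed.

Lemma square_in_index4 (G : finZmodType) (K L : {group G}) k (f : nat -> nat -> G) :
  K \subset L -> #|L : K|%g = 4%N -> square_in K 2 (2 * k) f ->
  exists g, square_in L 1 (4 * k) g.
Proof.
move=> sKL iKL [fK finj [mu [frow fcol fdiag fanti]]].
pose s := enum (rcosets K L).
have ss : size s = 4%N by rewrite -cardE.
pose c t : G := repr (nth set0 s t).
have csetE t : (t < 4)%N -> nth set0 s t = (K :* c t)%g /\ c t \in L.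
  move=> lt4; have : nth set0 s t \in rcosets K L by rewrite -mem_enum mem_nth ?ss.
  case/rcosetsP=> x Lx e; rewrite /c e; have := mem_repr_rcoset K x.
  move=> rx; split; first by rewrite rcoset_repr.
  by case/rcosetP: rx => y Ky ->; rewrite groupM // (subsetP sKL).
have cinj x y t u : (t < 4)%N -> (u < 4)%N -> x \in K -> y \in K ->
    x + c t = y + c u -> t = u /\ x = y.
  move=> ht hu Kx Ky e.
  have tu : t = u.
    apply/eqP; rewrite -(nth_uniq set0 (s := s)) ?ss ?enum_uniq //.
    have cosetD z v : z \in K -> (K :* c v = K :* (z + c v)%R)%g.
      by move=> Kz; rewrite -zmodMgE rcosetM (rcoset_id Kz).
    by rewrite (csetE t ht).1 (csetE u hu).1 (cosetD x) // (cosetD y) // e.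
  by split=> //; move: e; rewrite tu => /addIr.
pose g i j := f (i %/ 2)%N (j %/ 2)%N + c (diagonal_latin4 (i %% 4) (j %% 4)).
exists g; split.
- move=> i j hi hj; rewrite /g -zmodMgE groupM //.
    by apply: (subsetP sKL); apply: fK; lia.
  by apply: (csetE _ _).2; apply: diagonal_latin4_lt.
(* The coset of an entry reveals its Latin symbol, and cancelling the representative leaves the cell
   of [f], hence the 2x2 block. The symbol then fixes the position inside the block. *)
- move=> i j i' j' hi hj hi' hj' e.
  have [||||e1 e2] := cinj _ _ _ _ _ _ _ _ e; rewrite ?diagonal_latin4_lt //.
  + by apply: fK; lia.
  + by apply: fK; lia.
  have [||||ei ej] := finj _ _ _ _ _ _ _ _ e2; try lia.
  by case: (diagonal_latin4_block_inj _ _ _ _ _ _ e1); lia.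
pose C := c 0%N + c 1%N + c 2%N + c 3%N.
have cC i : (i < 4)%N -> c (diagonal_latin4 i 0) + c (diagonal_latin4 i 1)
    + c (diagonal_latin4 i 2) + c (diagonal_latin4 i 3) = C.
  case: i => [|[|[|[|i]]]] // _; rewrite /C /diagonal_latin4 /=.
  + by rewrite (ACl (1*2*4*3)).
  + by rewrite (ACl (4*3*1*2)).
  + by rewrite (ACl (2*1*3*4)).
  + by rewrite (ACl (3*4*2*1)).
have cC' i : (i < 4)%N -> c (diagonal_latin4 0 i) + c (diagonal_latin4 1 i)
    + c (diagonal_latin4 2 i) + c (diagonal_latin4 3 i) = C.
  case: i => [|[|[|[|i]]]] // _; rewrite /C /diagonal_latin4 /=.
  + by rewrite (ACl (1*3*2*4)).
  + by rewrite (ACl (3*1*4*2)).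
  + by rewrite (ACl (4*2*3*1)).
  + by rewrite (ACl (2*4*1*3)).
exists (mu + C *+ k); rewrite !mulr1n; split.
- move=> i hi; rewrite mulr1n.
  rewrite (sum_block_line (f (i %/ 2)%N) (fun t => c (diagonal_latin4 (i %% 4) t))).
  by rewrite frow ?cC ?ltn_mod //; lia.
- move=> j hj; rewrite mulr1n.
  rewrite (sum_block_line (f^~ (j %/ 2)%N) (fun t => c (diagonal_latin4 t (j %% 4)))).
  by rewrite fcol ?cC' ?ltn_mod //; lia.
- rewrite (sum_block_line (fun i => f i i) (fun t => c (diagonal_latin4 t t))).
  by rewrite fdiag /diagonal_latin4 /= (ACl (1*4*3*2)).
(* Column [4 * k - i.+1] lies in block column [2 * k - (i %/ 2).+1] and has residue [3 - i %% 4]: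
   the backward diagonal follows those of [f] and of the Latin square. *)
rewrite (eq_bigr (fun i : 'I_(4 * k) => f (i %/ 2)%N (2 * k - (i %/ 2).+1)%N +
    c (diagonal_latin4 (i %% 4) (3 - i %% 4)))); last first.
  move=> i _; have := ltn_ord i; rewrite /g => ltik.
  by congr (f _ _ + c (diagonal_latin4 _ _)); lia.
rewrite (sum_block_line (fun i => f i (2 * k - i.+1)%N)
  (fun t => c (diagonal_latin4 t (3 - t)))).
by rewrite fanti /diagonal_latin4 /= (ACl (3*2*1*4)).
Qed.

(** Every doubled sum vanishes, so the elements may be placed in any order. *)
Lemma square_in_klein (G : finZmodType) (E : {group G}) :
  #|E| = 4%N -> (forall x, x \in E -> x *+ 2 = 0) -> exists f, square_in E 2 2 f.
Proof.
move=> cE E2; pose f i j : G := nth 0 (enum E) (2 * i + j)%N.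
have sE : size (enum E) = 4%N by rewrite -cardE.
have fE i j : (i < 2)%N -> (j < 2)%N -> f i j \in E.
  by move=> hi hj; rewrite -mem_enum mem_nth // sE; lia.
exists f; split=> //.
  move=> i j i' j' hi hj hi' hj' /eqP; rewrite nth_uniq ?enum_uniq ?sE; lia.
have E20 (F : 'I_2 -> G) : (forall i, F i \in E) -> (\sum_i F i) *+ 2 = 0.
  by move=> FE; rewrite -sumrMnl big1 // => i _; apply: E2.
by exists 0; split=> *; apply: E20 => i; apply: fE => //; lia.
Qed.

Lemma square_in_cycle16 (G : finZmodType) (x : G) :
  #[x]%g = 16%N -> exists f, square_in <[x]>%g 1 4 f.
Proof.
move=> ox; pose f i j := x *+ classical_square4 i j.
exists f; split.
- by move=> i j _ _; rewrite /f -zmodXgE mem_cycle.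
- move=> i j i' j' hi hj hi' hj'; rewrite /f -!zmodXgE => /eqP.
  rewrite eq_expg_mod_order ox; move: hi hi' hj hj'.
  case: i => [|[|[|[|i]]]] //; case: i' => [|[|[|[|i']]]] // _ _;
  by case: j => [|[|[|[|j]]]] //; case: j' => [|[|[|[|j']]]].
(* The magic constant is (0 + ... + 15) / 4 = 30. *)
exists (x *+ 30); rewrite !mulr1n; split; last first.
- by rewrite !big_ord_recr big_ord0 /= add0r -!mulrnDr.
- by rewrite !big_ord_recr big_ord0 /= add0r -!mulrnDr.
- move=> j hj; rewrite mulr1n !big_ord_recr big_ord0 /= add0r -!mulrnDr.
  by case: j hj => [|[|[|[|j]]]].
- move=> j hj; rewrite mulr1n !big_ord_recr big_ord0 /= add0r -!mulrnDr.
  by case: j hj => [|[|[|[|j]]]].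
Qed.

Lemma square_in_order16 (G : finZmodType) (K : {group G}) :
  #|K| = 16%N -> exists f, square_in K 1 4 f.
Proof.
move=> cK; have pK : (2.-group K)%g by rewrite /pgroup cK.
have abK : abelian K by apply/centsP=> x _ y _; apply: zmod_mulgC.
case: (boolP (cyclic K)) => [/cyclicP[x Kx]|ncK].
  by rewrite Kx; apply: square_in_cycle16; rewrite orderE -Kx.
(* A non-cyclic abelian 2-group has rank at least 2, so it contains a Klein subgroup [E], here of
   index 4. *)
move: ncK; rewrite abelian_rank1_cyclic // -ltnNge (rank_pgroup pK).
case/p_rank_geP=> E /pnElemP[sEK abE lE].
have cE : #|E| = 4%N by rewrite (card_pgroup (abelem_pgroup abE)) lE.
have [|f fE] := square_in_klein cE.
  by move=> x Ex; case/abelemP: abE => // _ /(_ x Ex); rewrite zmodXgE.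
by apply: (square_in_index4 (k := 1) sEK _ fE); rewrite -divgS // cK cE.
Qed.

Lemma square_in_order_pow4 (G : finZmodType) (K : {group G}) a :
  #|K| = (2 ^ (2 * a.+2))%N -> exists f, square_in K 1 (2 ^ a.+2) f.
Proof.
elim: a K => [|a IH] K cK; first exact: square_in_order16.
have pK : (2.-group K)%g by rewrite /pgroup cK pnatX.
(* A 2-group has subgroups of every order dividing its own; [H] is chosen of index 4. *)
have [|H [sHK _ cH]] := normal_pgroup (r := 2 * a.+2) pK (normal_refl K).
  by rewrite cK pfactorK //; lia.
have [f [fH finj [mu [frow fcol fdiag fanti]]]] := IH H cH.
have -> : (2 ^ a.+3 = 4 * 2 ^ a.+1)%N by rewrite !expnS; lia.
apply: (square_in_index4 (f := f) sHK).
  rewrite -divgS // cK cH.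
  have -> : (2 * a.+3 = 2 + 2 * a.+2)%N by lia.
  by rewrite expnD mulnK ?expn_gt0.
(* Line sums that agree still agree after doubling, so [d] may pass from 1 to 2. *)
rewrite -expnS; split=> //; exists (mu *+ 2).
by split=> *; rewrite ?frow ?fcol // -(mulr1n (\sum_i _)) ?fdiag ?fanti ?frow ?fcol.
Qed.

Theorem theorem5p2 (G : finZmodType) (alpha : nat)
    (halpha : (2 <= alpha)%N) (hG : #|G| = (2 ^ (2 * alpha))%N) :
  exists M : 'M[G]_(2 ^ alpha), magic_square M.
Proof.
case: alpha halpha hG => [|[|a]] // _ hG.
have [f [_ finj [mu [frow fcol fdiag fanti]]]] :
    exists f, square_in [set: G] 1 (2 ^ a.+2) f.
  by apply: (square_in_order_pow4 (K := [set: G]%G)); rewrite cardsT.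
exists (\matrix_(i, j) f i j); split.
  (* Injectivity suffices, since the array has as many cells as [G] has elements. *)
  apply: inj_card_bij => [[i j] [i' j'] /=|].
    by rewrite !mxE => /finj[] // /val_inj -> /val_inj ->.
  by rewrite card_prod !card_ord hG mul2n -addnn expnD.
exists mu; split.
- by move=> i; rewrite -(frow i) // mulr1n; apply: eq_bigr => j _; rewrite mxE.
- by move=> j; rewrite -(fcol j) // mulr1n; apply: eq_bigr => i _; rewrite mxE.
- by rewrite -fdiag mulr1n; apply: eq_bigr => i _; rewrite mxE.
- by rewrite -fanti mulr1n; apply: eq_bigr => i _; rewrite mxE.
Qed.
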